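(* Let $X$ and $Y$ be $\alpha$-connected metric spaces of the same diameter, and assume that $d_2(X)\le(\operatorname{diam}X)/2$ and $d_2(Y)\le(\operatorname{diam}Y)/2$. Then $X$ and $Y$ are indistinguishable. In particular, for any cardinal numbers $\kappa,\mu$ greater than or equal to the continuum there exist indistinguishable metric spaces $X$ and $Y$ with $\#X=\kappa$ and $\#Y=\mu$.
   Context: All metric spaces are non-empty; $\#X$ is the cardinality of $X$, $|xy|$ is the distance between points, $|AB|=\inf\{|ab|:a\in A,\,b\in B\}$ for non-empty subsets, and $\operatorname{diam}X=\sup\{|xy|:x,y\in X\}$. $d_{GH}$ is the Gromov--Hausdorff distance (possibly infinite): the infimum of the $r$ such that $X$ and $Y$ embed isometrically in a common metric space with Hausdorff distance between their images at most $r$. For a cardinal $n\ge1$, $\Delta_n$ is the metric space of cardinality $n$ with all non-zero distances equal to $1$; for $\lambda>0$, $\lambda\Delta_n$ is obtained by multiplying all distances by $\lambda$, and $0\Delta_n:=\Delta_1$ (one point). The spaces $\lambda\Delta_n$ are called simplexes. Metric spaces $X$ and $Y$ are indistinguishable if $d_{GH}(\lambda\Delta_n,X)=d_{GH}(\lambda\Delta_n,Y)$ for every cardinal $n\ge1$ and every real $\lambda\ge0$. For a cardinal $1\le n\le\#X$, $\mathcal D_n(X)$ is the set of all partitions of $X$ into $n$ non-empty subsets. For $D=\{X_i\}_{i\in I}\in\mathcal D_n(X)$ put $\operatorname{diam}D=\sup_{i\in I}\operatorname{diam}X_i$ and, for $n\ge2$, $\alpha(D)=\inf\{|X_iX_j|:i\ne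 j\}$. Put $d_n(X)=\inf_{D\in\mathcal D_n(X)}\operatorname{diam}D$ and $\alpha_n(X)=\sup_{D\in\mathcal D_n(X)}\alpha(D)$. The space $X$ is $\alpha$-connected if $\alpha_n(X)=0$ for every cardinal $n$ with $2\le n\le\#X$. The hypothesis on $d_2$ presupposes that $X$ and $Y$ have at least two points. *)

(* Defs.v *)
From HB Require Import structures.
From mathcomp Require Import all_boot all_order all_algebra.
From mathcomp Require Import all_classical all_reals all_analysis.

Set Implicit Arguments.
Unset Strict Implicit.
Unset Printing Implicit Defensive.
Set Warnings "-redundant-canonical-projection".

Import Order.TTheory GRing.Theory Num.Theory.

Local Open Scope classical_set_scope.
Local Open Scope card_scope.
Local Open Scope ring_scope.
Local Open Scope ereal_scope.

(* A cardinal is represented by a type [n], standing for [#|n|], and cardinals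
   are compared through [#=] and [#<=].  A [metricType] may be empty, so
   non-emptiness has to be assumed where it matters. *)

Section diameter.
Context {R : realType} {X : metricType R}.
Implicit Types A B : set X.

Definition diam_set A : \bar R := ereal_sup [set (mdist x y)%:E | x in A & y in A].

Definition set_dist A B : \bar R := ereal_inf [set (mdist a b)%:E | a in A & b in B].

Definition hausdorff_dist A B : \bar R :=
  maxe (ereal_sup [set set_dist [set a] B | a in A])
       (ereal_sup [set set_dist [set b] A | b in B]).

End diameter.

Definition diam {R : realType} (X : metricType R) : \bar R := diam_set [set: X].

Definition isometric_embedding {R : realType} {X Z : metricType R} (f : X -> Z) :=
  forall x y, mdist (f x) (f y) = mdist x y.

(* Equal to [+oo] when no real [r] is admissible. *)
Definition dGH {R : realType} (X Y : metricType R) : \bar R :=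
  ereal_inf [set r%:E | r in [set r : R |
    exists (Z : metricType R) (f : X -> Z) (g : Y -> Z),
      [/\ isometric_embedding f, isometric_embedding g &
          hausdorff_dist (range f) (range g) <= r%:E]]].

Definition Delta (R : realType) (n : Type) : Type := n.

Section Delta_metric.
Context {R : realType} {n : Type}.

HB.instance Definition _ := gen_eqMixin (Delta R n).
HB.instance Definition _ := gen_choiceMixin (Delta R n).

Definition Delta_dist (x y : Delta R n) : R := (x != y)%:R.

Let Delta_distxx x : Delta_dist x x = 0%R.
Proof. by rewrite /Delta_dist eqxx. Qed.

Let Delta_dist_positivity x y : Delta_dist x y = 0%R -> x = y.
Proof.
by rewrite /Delta_dist; case: eqVneq => // _ /eqP; rewrite oner_eq0.
Qed.

Let Delta_dist_sym x y : Delta_dist x y = Delta_dist y x.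
Proof. by rewrite /Delta_dist eq_sym. Qed.

Let Delta_dist_triangle y x z :
  (Delta_dist x z <= Delta_dist x y + Delta_dist y z)%R.
Proof.
rewrite /Delta_dist -natrD ler_nat.
by have [->|xy] := eqVneq x y; rewrite ?add0n// (leq_trans (leq_b1 _)).
Qed.

HB.instance Definition _ := @isMetric.Build R (Delta R n) Delta_dist
  Delta_distxx Delta_dist_positivity Delta_dist_sym Delta_dist_triangle.

End Delta_metric.

Definition scaled {R : realType} (l : {posnum R}) (X : metricType R) : Type := X.

Section scaled_metric.
Context {R : realType} (l : {posnum R}) (X : metricType R).

HB.instance Definition _ := Choice.on (scaled l X).

Definition scaled_dist (x y : scaled l X) : R :=
  (l%:num * mdist (x : X) (y : X))%R.

Let scaled_distxx x : scaled_dist x x = 0%R.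
Proof. by rewrite /scaled_dist mdistxx mulr0. Qed.

Let scaled_dist_positivity x y : scaled_dist x y = 0%R -> x = y.
Proof.
by move/eqP; rewrite /scaled_dist mulf_eq0 gt_eqF//= => /eqP/mdist_positivity.
Qed.

Let scaled_dist_sym x y : scaled_dist x y = scaled_dist y x.
Proof. by rewrite /scaled_dist metric_sym. Qed.

Let scaled_dist_triangle y x z :
  (scaled_dist x z <= scaled_dist x y + scaled_dist y z)%R.
Proof. by rewrite /scaled_dist -mulrDr ler_pM2l// metric_triangle. Qed.

HB.instance Definition _ := @isMetric.Build R (scaled l X) scaled_dist
  scaled_distxx scaled_dist_positivity scaled_dist_sym scaled_dist_triangle.

End scaled_metric.

(* [lambda Delta_n], with [0 Delta_n := Delta_1]; only meant for [0 <= lambda]. *)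
Definition simplex {R : realType} (lambda : R) (n : Type) : metricType R :=
  if pselect (0 < lambda)%R is left lambda_gt0
  then scaled (PosNum lambda_gt0) (Delta R n)
  else Delta R unit.

Definition indistinguishable {R : realType} (X Y : metricType R) :=
  forall (n : Type) (lambda : R), inhabited n -> (0 <= lambda)%R ->
    dGH (simplex lambda n) X = dGH (simplex lambda n) Y.

Section partitions.
Context {R : realType}.

(* The partitions of [X] into [#|n|] non-empty subsets, each one given as the
   set of its blocks. *)
Definition partitions_into (n : Type) (X : metricType R) : set (set (set X)) :=
  [set D | partition D id [set: X] /\ D #= [set: n]].
Arguments partitions_into n X : clear implicits.

Definition diam_part {X : metricType R} (D : set (set X)) : \bar R :=
  ereal_sup [set diam_set A | A in D].

Definition alpha_part {X : metricType R} (D : set (set X)) : \bar R :=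
  ereal_inf [set set_dist P.1 P.2 | P in
    [set P : set X * set X | [/\ D P.1, D P.2 & P.1 <> P.2]]].

Definition d_ (n : Type) (X : metricType R) : \bar R :=
  ereal_inf [set diam_part D | D in partitions_into n X].

Definition alpha_ (n : Type) (X : metricType R) : \bar R :=
  ereal_sup [set alpha_part D | D in partitions_into n X].

Definition alpha_connected (X : metricType R) :=
  forall n : Type, [set: 'I_2] #<= [set: n] -> [set: n] #<= [set: X] ->
    alpha_ n X = 0.

End partitions.

(* Main.v *)
From HB Require Import structures.
Require Import Defs.
From mathcomp Require Import all_boot all_order all_algebra.
From mathcomp Require Import all_classical all_reals all_analysis.
From mathcomp Require Import ring lra.

(* Let [X] be alpha-connected and [S = lambda Delta_n] with [n >= 2] and
   [lambda > 0].  If [2 d_GH(S, X) < lambda], sending a point of [X] to the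
   nearest vertex of [S] cuts [X] into [n] pieces at positive mutual distances,
   which alpha-connectedness forbids; together with [diam X <= lambda + 2 d_GH]
   this bounds [2 d_GH] below by [max(lambda, diam X - lambda)].  The bound is
   attained up to epsilon by the correspondence matching one vertex of [S] with
   the first block of a partition of [X] into two blocks of diameter about
   [diam X / 2 <= max(lambda, diam X - lambda)], and every other vertex with the
   second block.  So the distance depends on [diam X] only.

   A space of prescribed infinite cardinality satisfying the hypotheses is a
   hedgehog with rational points: one spike of length 1 and the others of length
   1/4, with diameter 5/4, cut into two at height 3/8 of the long spike. *)

Set Implicit Arguments.
Unset Strict Implicit.
Unset Printing Implicit Defensive.

Import Order.TTheory GRing.Theory Num.Theory.

Local Open Scope classical_set_scope.
Local Open Scope card_scope.
Local Open Scope ring_scope.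

(** * Cardinal comparison by injections *)

Lemma card_leTT_inj (T U : Type) :
  [set: T] #<= [set: U] <-> exists f : T -> U, injective f.
Proof.
split=> [/card_leP[f]|[f finj]].
  exists (fun x => val (f (to_setT x))) => x y /val_inj.
  by move=> /(@inj _ _ setT f _ _ (mem_set I) (mem_set I))/(congr1 val).
have /injfunPex[g] : exists2 g : T -> U,
    set_fun [set: T] [set: U] g & set_inj [set: T] g.
  by exists f => // x y _ _; apply: finj.
exact: inj_card_le g.
Qed.

Lemma card_le2TP (T : Type) :
  [set: 'I_2] #<= [set: T] <-> exists x y : T, x <> y.
Proof.
rewrite card_leTT_inj; split=> [[f finj]|[x [y xy]]].
  by exists (f ord0), (f ord_max) => /finj.
exists (fun i : 'I_2 => if i == ord0 then x else y) => i j.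
by case: i => [[|[|//]] ?]; case: j => [[|[|//]] ?] //= e;
  try (by case: xy); apply/val_inj.
Qed.

(** * Gromov-Hausdorff distance to a simplex *)

Section correspondence_gluing.
Context {R : realType} {S X : metricType R}.
Variables (C : S -> X -> Prop) (r : R).
Hypothesis r_gt0 : 0 < r.
Hypothesis C_total : forall s, exists x, C s x.
Hypothesis C_surj : forall x, exists s, C s x.
Hypothesis C_distortion : forall s t x y, C s x -> C t y ->
  `|mdist s t - mdist x y| <= r *+ 2.

(** Lengths of the routes from [s] to [x] through a pair of [C]. Each pair is joined by an edge of
    length [r], which [cross] adds after taking the infimum; as [r > 0], no point of [S] gets
    identified with a point of [X]. *)
Let cross_set s x : set R :=
  [set d | exists t y, C t y /\ d = mdist s t + mdist y x].

Let cross s x : R := inf (cross_set s x) + r.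

Let cross_le s x t y : C t y -> cross s x <= mdist s t + mdist y x + r.
Proof.
move=> Cty; rewrite /cross lerD2r; apply: ge_inf; last by exists t, y.
by exists 0 => _ [u [z [_ ->]]]; rewrite addr_ge0 ?mdist_ge0.
Qed.

Let le_cross s x c :
  (forall t y, C t y -> c <= mdist s t + mdist y x + r) -> c <= cross s x.
Proof.
move=> cle; rewrite /cross -lerBlDr; apply: lb_le_inf.
  by have [y Csy] := C_total s; exists (mdist s s + mdist y x), s, y.
by move=> _ [t [y [Cty ->]]]; rewrite lerBlDr cle.
Qed.

Let r_le_cross s x : r <= cross s x.
Proof.
by apply: le_cross => t y _; rewrite lerDr addr_ge0 ?mdist_ge0.
Qed.

Let glue_dist (a b : S + X) : R :=
  match a, b with
  | inl s, inl t => mdist s t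
  | inr x, inr y => mdist x y
  | inl s, inr x => cross s x
  | inr x, inl s => cross s x
  end.

Let glue_distxx a : glue_dist a a = 0.
Proof. by case: a => ?; exact: mdistxx. Qed.

Let glue_dist_positivity a b : glue_dist a b = 0 -> a = b.
Proof.
case: a b => [s|x] [t|y] /=; try by move=> /mdist_positivity ->.
  by move: (r_le_cross s y) => /[swap] ->; rewrite leNgt r_gt0.
by move: (r_le_cross t x) => /[swap] ->; rewrite leNgt r_gt0.
Qed.

Let glue_dist_sym a b : glue_dist a b = glue_dist b a.
Proof. by case: a b => [s|x] [t|y] //=; exact: metric_sym. Qed.

Let cross_triangle_l s t x : cross s x <= mdist s t + cross t x.
Proof.
rewrite -lerBlDl; apply: le_cross => u y /(cross_le s x).
have := metric_triangle s t u; lra.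
Qed.

Let cross_triangle_r s x y : cross s x <= cross s y + mdist y x.
Proof.
rewrite -lerBlDr; apply: le_cross => u z /(cross_le s x).
have := metric_triangle z y x; lra.
Qed.

(** If the two crossings pass through the pairs [(u, y)] and [(v, z)], the distortion bound gives
    |uv| <= |yz| + 2r, and the two edges of length [r] pay for the 2r. The companion [cross_cross_r]
    uses the other half of the bound. *)
Let cross_cross_l s t x : mdist s t <= cross s x + cross t x.
Proof.
rewrite -lerBlDr; apply: le_cross => u y Cuy.
rewrite lerBlDr addrC -lerBlDr; apply: le_cross => v z Cvz.
have := C_distortion Cuy Cvz; rewrite ler_norml => /andP[_].
have := metric_triangle s u t; have := metric_triangle u v t.
have := metric_triangle y x z; rewrite (metric_sym v t) (metric_sym x z).
rewrite mulr2n; lra.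
Qed.

Let cross_cross_r s x y : mdist x y <= cross s x + cross s y.
Proof.
rewrite -lerBlDr; apply: le_cross => u w Cuw.
rewrite lerBlDr addrC -lerBlDr; apply: le_cross => v z Cvz.
have := C_distortion Cuw Cvz; rewrite ler_norml => /andP[+ _].
have := metric_triangle x w y; have := metric_triangle w z y.
have := metric_triangle u s v; rewrite (metric_sym u s) (metric_sym x w).
rewrite mulr2n; lra.
Qed.

Let glue_dist_triangle b a c :
  glue_dist a c <= glue_dist a b + glue_dist b c.
Proof.
case: a b c => [s|x] [t|y] [u|z] //=.
- exact: metric_triangle.
- by rewrite [leRHS]addrC (metric_sym t u); exact: cross_triangle_l.
- by rewrite [leRHS]addrC (metric_sym x y); exact: cross_triangle_r.
- exact: metric_triangle.
Qed.

(** In the glued space corresponding points are at distance at most [r], and every point has a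
    partner. *)
Lemma dGH_le_correspondence : (dGH S X <= r%:E)%E.
Proof.
apply: ereal_inf_lbound; exists r => //=.
pose Z : metricType R := HB.pack (S + X)%type
  (@isMetric.Build R (S + X)%type glue_dist glue_distxx glue_dist_positivity
    glue_dist_sym glue_dist_triangle).
have cross_le_r s x : C s x -> cross s x <= r.
  by move=> /(cross_le s x); rewrite !mdistxx !add0r.
exists Z, inl, inr; split=> //.
rewrite /hausdorff_dist ge_max; apply/andP; split; apply: ge_ereal_sup.
  move=> _ [_ [s _ <-] <-]; have [x Csx] := C_total s.
  apply: (@le_trans _ _ (cross s x)%:E); last by rewrite lee_fin cross_le_r.
  by apply: ereal_inf_lbound; exists (inl s) => //; exists (inr x).
move=> _ [_ [x _ <-] <-]; have [s Csx] := C_surj x.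
apply: (@le_trans _ _ (cross s x)%:E); last by rewrite lee_fin cross_le_r.
by apply: ereal_inf_lbound; exists (inr x) => //; exists (inl s).
Qed.

End correspondence_gluing.

(** * Diameters, fibre partitions and nearby points *)

Section diameter_theory.
Context {R : realType} {X : metricType R}.

Lemma mdist_le_diam_set (A : set X) x y : A x -> A y ->
  ((mdist x y)%:E <= diam_set A)%E.
Proof. by move=> Ax Ay; apply: ereal_sup_ubound; exists x => //; exists y. Qed.

Lemma diam_set_le (A : set X) (c : \bar R) :
  (forall x y, A x -> A y -> ((mdist x y)%:E <= c)%E) -> (diam_set A <= c)%E.
Proof. by move=> Ac; apply: ge_ereal_sup => _ [x Ax [y Ay <-]]; exact: Ac. Qed.

End diameter_theory.

Section fiber_partition.
Context {R : realType} {X : metricType R} {n : Type}.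
Variable phi : X -> n.
Hypothesis phi_surj : forall i, exists x, phi x = i.

Lemma fiber_partitions_into :
  partitions_into n (range (fun i => phi @^-1` [set i])).
Proof.
split; last first.
  apply: inj_card_eq => i j _ _ eq_ij; have [x xi] := phi_surj i.
  have : (phi @^-1` [set j]) x by rewrite -eq_ij.
  by rewrite /preimage/= xi.
split.
- apply/seteqP; split=> // x _.
  by exists (phi @^-1` [set phi x]) => //; exists (phi x).
- by move=> _ _ [i _ <-] [j _ <-] [x [/= <- <-]].
- by move=> _ [i _ <-]; have [x xi] := phi_surj i; exists x.
Qed.

(** The fibres of [phi] would form a partition into at least two blocks with [alpha_part] at least
    [delta]. A section of [phi] shows that this number of blocks does not exceed the cardinality of
    [X]. *)
Lemma alpha_connected_no_gap (delta : R) :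
  alpha_connected X -> (exists i j : n, i <> j) -> 0 < delta ->
  ~ (forall x y, phi x <> phi y -> delta <= mdist x y).
Proof.
move=> aX n2 delta0 gap.
have card_nX : [set: n] #<= [set: X].
  have [psi psiK] := choice phi_surj.
  by apply/card_leTT_inj; exists psi; exact: can_inj psiK.
have : (delta%:E <= alpha_ n X)%E.
  apply: le_trans (ereal_sup_ubound _); last first.
    by exists (range (fun i => phi @^-1` [set i])); [exact: fiber_partitions_into|].
  apply: le_ereal_inf_tmp => _ [[A B] [/= [i _ <-] [j _ <-] neq] <-].
  apply: le_ereal_inf_tmp => _ [x /= xi [y /= yj <-]]; rewrite lee_fin.
  by apply: gap => xy; apply: neq; rewrite -xi -yj xy.
by rewrite aX //; [rewrite lee_fin leNgt delta0|apply/card_le2TP].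
Qed.

End fiber_partition.

Lemma partitions_into2 (R : realType) (X : metricType R) (D : set (set X)) :
  partitions_into 'I_2 D ->
  exists A B, [/\ D A, D B, A !=set0, B !=set0 & forall x, A x \/ B x].
Proof.
move=> [[covD _ D0]]; rewrite card_eq_sym => /card_bijP[f [g fK gK]].
pose b i := val (f (to_setT i)); have Db i : D (b i) by exact: set_valP.
exists (b ord0), (b ord_max); split; [exact: Db|exact: Db| | |] => //.
- exact/D0/Db.
- exact/D0/Db.
move=> x; have : cover D id x by rewrite covD.
move=> [E DE Ex]; pose i := val (g (SigSub (mem_set DE))).
have Ei : E = b i.
  by rewrite /b/i; have -> : to_setT (val (g (SigSub (mem_set DE)))) =
    g (SigSub (mem_set DE)); [exact: val_inj|rewrite gK].
move: Ei; case: i => [[|[|//]] ?] Ei; [left|right]; move: Ex; rewrite Ei /=;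
  by congr (b _ x); exact: val_inj.
Qed.

(** Distances to a set are infima that may not be attained, hence the slack between [r] and [r']. *)
Lemma dGH_near (R : realType) (S X Z : metricType R) (f : S -> Z) (g : X -> Z)
    (r r' : R) :
  (hausdorff_dist (range f) (range g) <= r%:E)%E -> r < r' ->
  (forall s, exists x, mdist (f s) (g x) < r') /\
  (forall x, exists s, mdist (f s) (g x) < r').
Proof.
rewrite /hausdorff_dist ge_max => /andP[fg gf] rr'; split.
  move=> s; have : (set_dist [set f s] (range g) < r'%:E)%E.
    apply: le_lt_trans (_ : r%:E < _)%E; last by rewrite lte_fin.
    by apply: le_trans fg; apply: ereal_sup_ubound; exists (f s) => //; exists s.
  by move=> /ereal_inf_lt[_ [_ -> [_ [x _ <-] <-]]]; rewrite lte_fin; exists x.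
move=> x; have : (set_dist [set g x] (range f) < r'%:E)%E.
  apply: le_lt_trans (_ : r%:E < _)%E; last by rewrite lte_fin.
  by apply: le_trans gf; apply: ereal_sup_ubound; exists (g x) => //; exists x.
move=> /ereal_inf_lt[_ [_ -> [_ [s _ <-] <-]]]; rewrite lte_fin metric_sym.
by exists s.
Qed.

(** * Comparing the distances from an equilateral space to two spaces *)

Section equilateral.
Context {R : realType} {S : metricType R}.
Variable lambda : R.
Hypothesis S_inhabited : inhabited S.
Hypothesis S_equilateral : forall s t : S, s <> t -> mdist s t = lambda.

(** The roles are split: [X] supplies the lower bounds on its own distance to [S], and [Y] the
    two-block partition that meets them. Exchanging [X] and [Y] then yields equality. *)
Lemma dGH_equilateral_le (X Y : metricType R) :
  inhabited Y -> alpha_connected X -> (diam Y <= diam X)%E ->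
  (d_ 'I_2 Y <= diam Y * (2^-1)%:E)%E -> (dGH S Y <= dGH S X)%E.
Proof.
move=> [y0] aX diamYX d2Y; have [s0] := S_inhabited.
apply: le_ereal_inf_tmp => _ [r [Z [f [g [isof isog fg_le]]]] <-].
suff le_e (e : R) : 0 < e -> (dGH S Y <= (r + e)%:E)%E.
  by apply/lee_addgt0Pr => e /le_e; rewrite EFinD.
move=> e_gt0.
(* One half of [e] pays for nearest points that may not exist, the other for a partition that only
   almost attains [d_ 'I_2 Y]. *)
have r_lt : r < r + e / 2 by lra.
have [near_f near_g] := dGH_near fg_le r_lt.
have r_gt0 : 0 < r + e / 2.
  by have [x fx] := near_f s0; apply: le_lt_trans fx; exact: mdist_ge0.
have [phi phi_near] := choice near_g.
(* In [Z], two points of [X] are joined through their vertices under [phi], each less than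
   [r + e / 2] away. *)
have diamY L : (forall s t : S, mdist s t <= L) ->
    (diam Y <= ((r + e / 2) *+ 2 + L)%:E)%E.
  move=> SL; apply: le_trans diamYX _; apply: diam_set_le => x y _ _.
  rewrite lee_fin -isog; have := SL (phi x) (phi y); rewrite -isof.
  have := phi_near x; have := phi_near y.
  have := metric_triangle (g x) (f (phi x)) (g y).
  have := metric_triangle (f (phi x)) (f (phi y)) (g y).
  rewrite (metric_sym (g x) (f _)); lra.
(* When [S] is a single point, the full relation has distortion [diam Y], which [diamY] bounds with
   [L = 0]. *)
have [S1|/existsNP[s1 /existsNP[t1 neq1]]] := pselect (forall s t : S, s = t).
  apply: (@dGH_le_correspondence _ _ _ (fun _ _ => True)).
  - lra.
  - by move=> s; exists y0.
  - by move=> y; exists s0.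
  move=> s t x y _ _; rewrite (S1 s t) mdistxx sub0r normrN ger0_norm ?mdist_ge0//.
  have S0 s' t' : mdist (s' : S) t' <= 0 by rewrite (S1 s' t') mdistxx.
  have := le_trans (@mdist_le_diam_set _ Y setT x y I I) (diamY 0 S0).
  by rewrite lee_fin; lra.
have lambda_gt0 : 0 < lambda.
  rewrite -(S_equilateral neq1) lt_neqAle mdist_ge0 andbT eq_sym.
  by apply/eqP => /mdist_positivity.
have S_le (s t : S) : mdist s t <= lambda.
  have [->|/eqP st] := eqVneq s t; first by rewrite mdistxx ltW.
  by rewrite S_equilateral.
(* Otherwise balls of radius [r + e / 2] around distinct vertices are disjoint, so [phi] is onto and
   its fibres lie at least [lambda - (r + e / 2) *+ 2] apart. *)
have lambda_le : lambda <= (r + e / 2) *+ 2.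
  rewrite leNgt; apply/negP => gap.
  have phi_uniq s x : mdist (f s) (g x) < r + e / 2 -> phi x = s.
    move=> fsgx; apply: contrapT => neq; have := S_equilateral neq; rewrite -isof.
    have := metric_triangle (f (phi x)) (g x) (f s).
    rewrite (metric_sym (g x)).
    have := phi_near x; move: gap; lra.
  apply: (@alpha_connected_no_gap _ _ _ phi _ (lambda - (r + e / 2) *+ 2)) => //.
  - by move=> s; have [x fx] := near_f s; exists x; exact: phi_uniq.
  - by exists s1, t1.
  - by rewrite subr_gt0.
  move=> x y neq; have := S_equilateral neq; rewrite -isof -isog.
  have := metric_triangle (f (phi x)) (g x) (f (phi y)).
  have := metric_triangle (g x) (g y) (f (phi y)).
  rewrite (metric_sym (g y) (f _)); have := phi_near x; have := phi_near y; lra.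
(* Half of [diam Y] is at most [((r + e / 2) *+ 2 + lambda) / 2], which [lambda_le] bounds by
   [(r + e / 2) *+ 2]. *)
have /ereal_inf_lt[_ [D D2 <-]] : (d_ 'I_2 Y < ((r + e) *+ 2)%:E)%E.
  apply: le_lt_trans d2Y _.
  apply: le_lt_trans (_ : (((r + e / 2) *+ 2 + lambda)%:E * (2^-1)%:E < _)%E).
    by apply: lee_wpmul2r => //; exact: diamY.
  by rewrite -EFinM lte_fin; move: lambda_le; lra.
move=> D_lt; have [A [B [DA DB [a Aa] [b Bb] AB]]] := partitions_into2 D2.
have block_le E x y : D E -> E x -> E y -> mdist x y <= (r + e) *+ 2.
  move=> DE Ex Ey; rewrite -lee_fin; apply: le_trans (mdist_le_diam_set Ex Ey) _.
  by apply: le_trans (ltW D_lt); apply: ereal_sup_ubound; exists E.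
apply: (@dGH_le_correspondence _ _ _ (fun s y => if s == s1 then A y else B y)).
- lra.
- by move=> s; case: (s == s1); [exists a|exists b].
- move=> y; have [Ay|By] := AB y; [exists s1|exists t1].
    by rewrite eqxx.
  by case: eqVneq => // /esym.
move=> s t x y; have [->|/eqP st] := eqVneq s t.
  move=> Cx Cy; rewrite mdistxx sub0r normrN ger0_norm ?mdist_ge0//.
  by move: Cx Cy; case: ifP => _; exact: block_le.
(* For distinct vertices, lambda - |xy| is at most [lambda], and |xy| - lambda at most
   [diam Y - lambda]; [lambda_le] and [diamY] bound these. *)
move=> _ _; rewrite (S_equilateral st) ler_norml.
have := le_trans (@mdist_le_diam_set _ Y setT x y I I) (diamY _ S_le).
rewrite lee_fin; have := mdist_ge0 x y; move: lambda_le.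
by move=> *; apply/andP; split; lra.
Qed.

End equilateral.

Lemma simplex_equilateral (R : realType) (lambda : R) (n : Type) :
  0 <= lambda -> forall s t : simplex lambda n, s <> t -> mdist s t = lambda.
Proof.
move=> _; rewrite /simplex; case: pselect => [lambda_gt0|?] s t st.
  suff st1 : Delta_dist (s : Delta R n) t = 1.
    by rewrite -[RHS]mulr1 -st1.
  by rewrite /Delta_dist; case: eqVneq st.
by case: st; case: s; case: t.
Qed.

Lemma simplex_inhabited (R : realType) (lambda : R) (n : Type) :
  inhabited n -> inhabited (simplex lambda n).
Proof.
by move=> [i]; rewrite /simplex; case: pselect => ?;
  [exact: (inhabits i)|exact: (inhabits tt)].
Qed.

Lemma alpha_connected_indistinguishable (R : realType) (X Y : metricType R) :
  [set: 'I_2] #<= [set: X] -> [set: 'I_2] #<= [set: Y] ->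
  alpha_connected X -> alpha_connected Y -> diam X = diam Y ->
  (d_ 'I_2 X <= diam X * (2^-1)%:E)%E ->
  (d_ 'I_2 Y <= diam Y * (2^-1)%:E)%E ->
  indistinguishable X Y.
Proof.
move=> /card_le2TP[x _] /card_le2TP[y _] aX aY XY dX dY n lambda n0 lambda0.
have S0 := @simplex_inhabited R lambda n n0.
have Seq := @simplex_equilateral R lambda n lambda0.
apply/eqP; rewrite eq_le; apply/andP; split.
  by apply: (dGH_equilateral_le S0 Seq (inhabits x) aY _ dX); rewrite XY.
by apply: (dGH_equilateral_le S0 Seq (inhabits y) aX _ dY); rewrite XY.
Qed.

(** * Splitting a countable factor off an infinite set *)

Lemma card_eqTT_inj (T U : Type) (f : T -> U) (g : U -> T) :
  injective f -> injective g -> [set: T] #= [set: U].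
Proof.
move=> finj ginj; apply/card_eqPle.
by split; apply/card_leTT_inj; [exists f|exists g].
Qed.

(* [J] is a maximal family of injections [nat -> T] with pairwise disjoint
   ranges; by maximality these ranges cover all but finitely many points. *)
Lemma infinite_set_prod_countable (T : Type) (C : countType) :
  infinite_set [set: T] -> infinite_set [set: C] ->
  exists J : Type, inhabited J /\ [set: J * C] #= [set: T].
Proof.
move=> Tinf /infiniteP/card_leTT_inj[c cinj].
pose disjoint_sequences (A : set (nat -> T)) :=
  (forall f, A f -> injective f) /\
  (forall f g m n, A f -> A g -> f m = g n -> f = g).
have [|A [[Ainj Adisj] Amax]] := @Zorn_bigcup _ disjoint_sequences.
- move=> F FP Ftot; split=> [f [A FA Af]|f g m n [A FA Af] [B FB Bg]].
    exact: (FP A FA).1.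
  have [AB|BA] := Ftot _ _ FA FB.
    by apply: (FP B FB).2 => //; exact: AB.
  by apply: (FP A FA).2 => //; exact: BA.
pose rest := [set x : T | forall f n, A f -> f n <> x].
(* Infinitely many uncovered points would contain one more sequence [g], against maximality. *)
have rest_fin : finite_set rest.
  apply: contrapT => /infiniteP; rewrite -(card_le_eqr (card_setT rest)).
  move=> /card_leTT_inj[h hinj]; pose g n : T := val (h n).
  have rest_g n : rest (g n) by exact: set_valP.
  apply: (Amax (A `|` [set g])).
    split; first by move=> f Af; left.
    by move=> /(_ g (or_intror erefl)) /(rest_g 0%N g 0%N); apply.
  split=> [f [/Ainj//|->]|f1 f2 m n [Af1|->] [Af2|->]//].
  - by move=> i j /val_inj /hinj.
  - exact: Adisj.
  - by move=> /(rest_g n f1 m Af1).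
  - by move=> /esym /(rest_g m f2 n Af2).
have [f0 Af0] : A !=set0.
  apply/set0P/eqP => A0; apply: Tinf; apply: sub_finite_set rest_fin => x _ f n.
  by rewrite A0.
have /countable_injP[r rinj] := finite_set_countable rest_fin.
exists {f | A f}; split; first exact: inhabits (exist _ f0 Af0).
(* The boolean separates the leftover points, all filed under [f0], from the points lying on a
   sequence, filed under that sequence and their index. *)
have /choice[q qP] x : exists q : {f | A f} * (bool * nat),
    (rest x /\ q.2 = (true, r x) /\ sval q.1 = f0) \/
    (q.2.1 = false /\ sval q.1 q.2.2 = x).
  have [xr|] := pselect (rest x).
    by exists (exist _ f0 Af0, (true, r x)); left.
  move=> /existsNP[f /existsNP[n /not_implyP[Af /contrapT fn]]].
  by exists (exist _ f Af, (false, n)); right.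
have qinj : injective q.
  move=> x y qxy; have := qP x; have := qP y; rewrite -qxy.
  case=> [[ry [qy _]]|[qy yE]]; case=> [[rx [qx _]]|[qx xE]].
  - by move: qx; rewrite qy => -[/rinj->//]; exact: mem_set.
  - by rewrite qy in qx.
  - by rewrite qx in qy.
  - exact: etrans (esym xE) yE.
(* Two injections for the Cantor-Bernstein argument: an element of [C] is read as an index into the
   sequence, and back, the code in [bool * nat] becomes a natural number that [c] sends into [C]. *)
pose to_T (p : {f | A f} * C) := sval p.1 (pickle p.2).
pose of_T x : {f | A f} * C := ((q x).1, c (pickle (q x).2)).
apply: (@card_eqTT_inj _ _ to_T of_T).
  move=> [[f Af] i] [[g Ag] j] /= fg; have fg_eq := Adisj _ _ _ _ Af Ag fg.
  subst g; move: fg => /(Ainj _ Af) /(pcan_inj pickleK) /= ->.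
  by congr (_, _); exact: eq_exist.
move=> x y [q1 /cinj /(pcan_inj pickleK) q2]; apply: qinj.
by rewrite [q x]surjective_pairing q1 q2 -surjective_pairing.
Qed.

(** * Hedgehogs *)

(** Any two points are joined by chains with arbitrarily small steps; phrased through sets closed
    under such steps, so that no chain has to be constructed. *)
Definition chain_connected {R : realType} (X : metricType R) :=
  forall (e : R) (A : set X), 0 < e -> A !=set0 ->
    (forall x y, A x -> mdist x y < e -> A y) -> A = setT.

Lemma partitions_into_nonempty (R : realType) (X : metricType R) (n : Type) :
  inhabited n -> [set: n] #<= [set: X] ->
  exists D : set (set X), partitions_into n D.
Proof.
move=> [i0] /card_leTT_inj[f finj].
have /choice[phi phiP] x : exists i, forall j, f j = x -> i = j.
  have [[j jx]|nfx] := pselect (exists j, f j = x).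
    by exists j => k kx; apply: finj; rewrite jx.
  by exists i0 => j jx; case: nfx; exists j.
eexists; apply: (@fiber_partitions_into _ _ _ phi) => i.
by exists (f i); exact: phiP.
Qed.

(** If distinct blocks are at least [e] apart, a block is closed under steps shorter than [e], hence
    is the whole space and leaves no room for a second block. *)
Lemma chain_connected_alpha_connected (R : realType) (X : metricType R) :
  chain_connected X -> alpha_connected X.
Proof.
move=> cX n n2 nX; have /card_le2TP[i [j ij]] := n2.
apply/eqP; rewrite eq_le; apply/andP; split; last first.
  (* The supremum over an empty family would be -oo, so nonnegativity needs an actual partition. *)
  have [D Dn] := partitions_into_nonempty (inhabits i) nX.
  apply: le_trans (ereal_sup_ubound _); last by exists D; [exact: Dn|].
  apply: le_ereal_inf_tmp => _ [P _ <-].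
  by apply: le_ereal_inf_tmp => _ [x _ [y _ <-]]; rewrite lee_fin mdist_ge0.
apply: ge_ereal_sup => _ [D [[covD trivD D0] Dn] <-].
rewrite leNgt; apply/negP => alpha_gt0.
have [e e_gt0 e_le] : exists2 e : R, 0 < e & (e%:E <= alpha_part D)%E.
  case: (alpha_part D) alpha_gt0 => [a a0|_|//]; first by exists a.
  by exists 1; rewrite ?leey.
have : [set: 'I_2] #<= D by rewrite (card_le_eqr Dn).
rewrite -(card_le_eqr (card_setT D)) => /card_le2TP[A' [B' AB']].
have AB : val A' <> val B' by move/val_inj.
have DA : D (val A') by exact: set_valP.
have DB : D (val B') by exact: set_valP.
move: (val A') (val B') DA DB AB => A B DA DB AB.
have AT : A = setT.
  apply: (cX e A e_gt0 (D0 _ DA)) => x y Ax xy.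
  have [C DC Cy] : cover D id y by rewrite covD.
  suff -> : A = C by [].
  apply: contrapT => AC; move: xy; apply/negP; rewrite -leNgt -lee_fin.
  apply: le_trans e_le _; apply: le_trans (_ : _ <= set_dist A C)%E _.
    by apply: ereal_inf_lbound; exists (A, C).
  by apply: ereal_inf_lbound; exists x => //; exists y.
have [b Bb] := D0 _ DB.
by apply/AB/trivD => //; exists b; rewrite AT.
Qed.

(** Coordinates along a spike. Rational values make a spike countable, as the cardinality count
    requires; leaving out 0 avoids identifying the centres of the spikes, so that a hedgehog is a
    plain product. *)
Definition unit_rat := {q : rat | 0 < q <= 1}.

Definition mk_unit_rat (q : rat) (q01 : 0 < q <= 1) : unit_rat := exist _ q q01.

Lemma unit_rat_infinite : infinite_set [set: unit_rat].
Proof.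
have H (n : nat) : 0 < (n.+1%:R^-1 : rat) <= 1.
  by rewrite invr_gt0 ltr0Sn/= invf_le1 ?ltr0Sn// ler1n.
apply/infiniteP/card_leTT_inj; exists (fun n => mk_unit_rat (H n)) => m n.
by move=> /(congr1 val) /= /invr_inj /eqP; rewrite eqr_nat => /eqP[].
Qed.

(* The spikes are indexed by [K] and meet, in the completion, at their common
   missing endpoint; the spike [k0] has length [1], all the others [1/4]. *)
Definition hedgehog (R : realType) (K : Type) (k0 : K) : Type :=
  (K * unit_rat)%type.

(** * The metric, chain-connectedness, diameter and [d_ 'I_2] of a hedgehog *)

Section hedgehog_metric.
Context {R : realType} {K : Type} {k0 : K}.

HB.instance Definition _ := gen_eqMixin (hedgehog R k0).
HB.instance Definition _ := gen_choiceMixin (hedgehog R k0).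

Implicit Types x y z : hedgehog R k0.

Definition spike_length (k : K) : R := if pselect (k = k0) then 1 else 4^-1.

Definition height x : R := ratr (val x.2) * spike_length x.1.

Definition hedgehog_dist x y : R :=
  if pselect (x.1 = y.1) then `|height x - height y| else height x + height y.

Lemma spike_length_k0 : spike_length k0 = 1.
Proof. by rewrite /spike_length; case: pselect. Qed.

Lemma spike_lengthN k : k <> k0 -> spike_length k = 4^-1.
Proof. by rewrite /spike_length; case: pselect. Qed.

Lemma spike_length_gt0 k : 0 < spike_length k.
Proof. by rewrite /spike_length; case: pselect => ? /=; lra. Qed.

Lemma spike_length_le1 k : spike_length k <= 1.
Proof. by rewrite /spike_length; case: pselect => ? /=; lra. Qed.

Lemma height_gt0 x : 0 < height x.
Proof.
rewrite mulr_gt0 ?spike_length_gt0// ltr0q.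
by have /andP[] := valP x.2.
Qed.

Lemma height_le x : height x <= spike_length x.1.
Proof.
rewrite ler_piMl ?(ltW (spike_length_gt0 _))//.
by have /andP[_] := valP x.2; rewrite -(ler_rat R) rmorph1.
Qed.

Lemma hedgehog_dist_same x y : x.1 = y.1 ->
  hedgehog_dist x y = `|height x - height y|.
Proof. by rewrite /hedgehog_dist; case: pselect. Qed.

Lemma hedgehog_dist_diff x y : x.1 <> y.1 ->
  hedgehog_dist x y = height x + height y.
Proof. by rewrite /hedgehog_dist; case: pselect. Qed.

Let hedgehog_distxx x : hedgehog_dist x x = 0.
Proof. by rewrite hedgehog_dist_same// subrr normr0. Qed.

Let hedgehog_dist_sym x y : hedgehog_dist x y = hedgehog_dist y x.
Proof.
have [xy|xy] := pselect (x.1 = y.1).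
  by rewrite !hedgehog_dist_same// distrC.
by rewrite !hedgehog_dist_diff 1?addrC//; exact/nesym.
Qed.

Let hedgehog_dist_positivity x y : hedgehog_dist x y = 0 -> x = y.
Proof.
have [xy|xy] := pselect (x.1 = y.1); last first.
  rewrite hedgehog_dist_diff// => dist0; exfalso.
  by have := height_gt0 x; have := height_gt0 y; move: dist0; lra.
rewrite hedgehog_dist_same// => /normr0_eq0/subr0_eq; rewrite /height xy.
move=> /(mulIf (lt0r_neq0 (spike_length_gt0 _))) /fmorph_inj /val_inj xy2.
by rewrite [x]surjective_pairing xy xy2 -surjective_pairing.
Qed.

(** Height is 1-Lipschitz. This gives the triangle inequality when the outer points share a spike;
    otherwise one of the two legs changes spike and the other is bounded by a height difference. *)
Let hedgehog_dist_bounds x y :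
  height x - height y <= hedgehog_dist x y /\
  height y - height x <= hedgehog_dist x y.
Proof.
have := height_gt0 x; have := height_gt0 y.
have [xy|xy] := pselect (x.1 = y.1).
  by rewrite hedgehog_dist_same// => *; split;
    rewrite ?ler_norml ?ler_normr; lra.
by rewrite hedgehog_dist_diff// => *; split; lra.
Qed.

Let hedgehog_dist_triangle y x z :
  hedgehog_dist x z <= hedgehog_dist x y + hedgehog_dist y z.
Proof.
have [xy1 xy2] := hedgehog_dist_bounds x y.
have [yz1 yz2] := hedgehog_dist_bounds y z.
have [xz|xz] := pselect (x.1 = z.1).
  by rewrite hedgehog_dist_same// ler_norml; apply/andP; split; lra.
rewrite (hedgehog_dist_diff xz).
have [xy|/hedgehog_dist_diff ->] := pselect (x.1 = y.1); last lra.
rewrite (@hedgehog_dist_diff y z); first by lra.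
by rewrite -xy.
Qed.

HB.instance Definition _ := @isMetric.Build R (hedgehog R k0) hedgehog_dist
  hedgehog_distxx hedgehog_dist_positivity hedgehog_dist_sym
  hedgehog_dist_triangle.

Lemma mdist_hedgehogE x y : mdist x y = hedgehog_dist x y.
Proof. by []. Qed.

Lemma hedgehog_chain_connected : chain_connected (hedgehog R k0).
Proof.
move=> e A e_gt0 [[k p] Akp] A_step.
(* Moving along one spike by repeated halving: [m] counts the bisections, and the midpoint of two
   rationals stays in [unit_rat]. *)
have spike m (j : K) (q q' : unit_rat) :
    `|ratr (val q) - ratr (val q')| < e * 2 ^+ m -> A (j, q) -> A (j, q').
  elim: m q q' => [|m IHm] q q' qq' Aq.
    apply: A_step Aq _; rewrite mdist_hedgehogE hedgehog_dist_same//.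
    rewrite /height /= -mulrBl normrM (gtr0_norm (spike_length_gt0 _)).
    apply: le_lt_trans (_ : `|ratr (val q) - ratr (val q')| < _).
      by rewrite ler_piMr// spike_length_le1.
    by rewrite expr0 mulr1 in qq'.
  have mid : 0 < (val q + val q') / 2 <= 1.
    by have := valP q; have := valP q'; lra.
  pose r : unit_rat := mk_unit_rat mid.
  have rE : ratr (val r) = (ratr (val q) + ratr (val q')) / 2 :> R.
    by rewrite /= fmorph_div rmorphD/= ratr_nat.
  have {}qq' : `|(ratr (val q) - ratr (val q')) / 2| < e * 2 ^+ m.
    rewrite normrM [`|2^-1|]gtr0_norm ?invr_gt0 ?ltr0n//.
    by rewrite ltr_pdivrMr ?ltr0n// -mulrA -exprSr.
  apply: (IHm r); last apply: (IHm q r _ Aq).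
    rewrite rE; apply: le_lt_trans qq'; rewrite le_eqVlt; apply/orP; left.
    by apply/eqP; congr `|_|; lra.
  rewrite rE; apply: le_lt_trans qq'; rewrite le_eqVlt; apply/orP; left.
  by apply/eqP; congr `|_|; lra.
have spike_all (j : K) (q q' : unit_rat) : A (j, q) -> A (j, q').
  apply: (@spike (Num.bound (2 / e))).
  apply: le_lt_trans (_ : 2 < _).
    have bnd (s : unit_rat) : 0 <= (ratr (val s) : R) <= 1.
      have /andP[s0 s1] := valP s.
      by rewrite ler0q (ltW s0)/=; move: s1; rewrite -(ler_rat R) rmorph1.
    by have := bnd q; have := bnd q'; rewrite ler_norml; lra.
  by rewrite mulrC -ltr_pdivrMr//; exact: upper_nthrootP.
(* To change spike, descend to coordinate 1/(m+1): two such points have height below [e / 2], so the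
   jump between them is shorter than [e]. *)
have [m] := @ltr_add_invr R 0 (e / 2) ltac:(lra).
rewrite add0r => m_lt.
have small_rat : 0 < (m.+1%:R^-1 : rat) <= 1.
  by rewrite invr_gt0 ltr0Sn/= invf_le1 ?ltr0Sn// ler1n.
pose s : unit_rat := mk_unit_rat small_rat.
have s_lt j : height ((j, s) : hedgehog R k0) < e / 2.
  apply: le_lt_trans m_lt; rewrite /height/= fmorphV rmorph_nat.
  by rewrite ler_piMr ?invr_ge0 ?ler0n// spike_length_le1.
apply/seteqP; split=> // -[j q] _; apply: (spike_all j s).
have [->|kj] := pselect (j = k); first exact: spike_all Akp.
apply: A_step (spike_all k p s Akp) _.
rewrite mdist_hedgehogE hedgehog_dist_diff; last by apply/nesym.
by have := s_lt j; have := s_lt k; lra.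
Qed.

Let height_le1 x : height x <= 1.
Proof.
exact: le_trans (height_le x) (spike_length_le1 _).
Qed.

Let height_Nk0 x : x.1 <> k0 -> height x <= 4^-1.
Proof.
move=> xk0; apply: le_trans (height_le x) _.
by rewrite spike_lengthN.
Qed.

Let unit_rat1 : unit_rat.
Proof. by exists 1; rewrite ltr01 lexx. Defined.

Let height_tip k : height ((k, unit_rat1) : hedgehog R k0) = spike_length k.
Proof. by rewrite /height/= rmorph1 mul1r. Qed.

Variable k1 : K.
Hypothesis k10 : k1 <> k0.

Lemma diam_hedgehog : diam (hedgehog R k0) = (5 / 4)%:E.
Proof.
apply/eqP; rewrite eq_le; apply/andP; split.
  apply: diam_set_le => x y _ _; rewrite lee_fin mdist_hedgehogE.
  have := height_le1 x; have := height_le1 y.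
  have := height_gt0 x; have := height_gt0 y.
  have [xy|xy] := pselect (x.1 = y.1).
    by rewrite hedgehog_dist_same// ler_norml; lra.
  rewrite hedgehog_dist_diff//.
  have [xk0|/height_Nk0] := pselect (x.1 = k0); last lra.
  have : y.1 <> k0 by rewrite -xk0; exact/nesym.
  by move=> /height_Nk0; lra.
(* The diameter is attained between the tip of the long spike and the tip of a short one. *)
have -> : 5 / 4 = mdist ((k0, unit_rat1) : hedgehog R k0) (k1, unit_rat1).
  rewrite mdist_hedgehogE hedgehog_dist_diff; last exact/nesym.
  by rewrite !height_tip spike_length_k0 spike_lengthN//; lra.
exact: mdist_le_diam_set.
Qed.

Lemma d2_hedgehog :
  (d_ 'I_2 (hedgehog R k0) <= diam (hedgehog R k0) * (2^-1)%:E)%E.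
Proof.
(* The cut at height t solves 1 - t = t + 1/4: the upper piece has diameter at most 1 - t, the lower
   one at most t + 1/4, and both are 5/8 at t = 3/8. *)
pose top x := x.1 = k0 /\ 3 / 8 < height x.
pose phi x : 'I_2 := if pselect (top x) then ord0 else ord_max.
have phi_surj i : exists x, phi x = i.
  case: i => [[|[|//]] i_lt].
    exists (k0, unit_rat1); rewrite /phi; case: pselect => [?|[]].
      exact: val_inj.
    by split; rewrite // height_tip spike_length_k0; lra.
  exists (k1, unit_rat1); rewrite /phi; case: pselect => [[]//|?].
  exact: val_inj.
apply: le_trans (ereal_inf_lbound _) _.
  by exists (range (fun i => phi @^-1` [set i])); [exact: fiber_partitions_into|].
rewrite diam_hedgehog -EFinM; apply: ge_ereal_sup => _ [_ [i _ <-] <-].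
apply: diam_set_le => x y /= <- yx; rewrite lee_fin mdist_hedgehogE.
have := height_le1 x; have := height_le1 y.
have := height_gt0 x; have := height_gt0 y.
have low z : ~ top z -> height z <= 3 / 8.
  move=> ntop; have [zk0|/height_Nk0] := pselect (z.1 = k0); last lra.
  by rewrite leNgt; apply/negP => z_gt; apply: ntop.
have phiE z : phi z = ord0 <-> top z.
  by rewrite /phi; case: pselect => ?; split.
have [[xk0 x_gt]|x_low] := pselect (top x).
  have [yk0 y_gt] : top y by apply/phiE; rewrite yx; apply/phiE.
  by rewrite hedgehog_dist_same ?xk0// ler_norml; lra.
have x_le := low x x_low.
have y_le : height y <= 3 / 8.
  by apply: low => /phiE; rewrite yx => /phiE.
have [xy|xy] := pselect (x.1 = y.1).
  by rewrite hedgehog_dist_same// ler_norml; lra.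
rewrite hedgehog_dist_diff//.
have [xk0|/height_Nk0] := pselect (x.1 = k0); last lra.
have : y.1 <> k0 by rewrite -xk0; exact/nesym.
by move=> /height_Nk0; lra.
Qed.

End hedgehog_metric.

(** Spikes are indexed by [J * bool], the boolean providing a second spike whatever [J] is. The
    diameter 5/4 does not depend on [kappa], so hedgehogs of different cardinalities can be
    compared. *)
Lemma exists_hedgehog_of_card (R : realType) (kappa : Type) :
  infinite_set [set: kappa] ->
  exists X : metricType R, [/\ [set: X] #= [set: kappa],
    [set: 'I_2] #<= [set: X], alpha_connected X, diam X = (5 / 4)%:E &
    (d_ 'I_2 X <= diam X * (2^-1)%:E)%E].
Proof.
move=> kappa_inf.
have C_inf : infinite_set [set: bool * unit_rat].
  apply/infiniteP; have /infiniteP/card_leTT_inj[f finj] := unit_rat_infinite.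
  by apply/card_leTT_inj; exists (fun n => (true, f n)) => m n [/finj].
have [J [[j] JC]] := infinite_set_prod_countable kappa_inf C_inf.
pose k0 := (j, true); pose k1 := (j, false).
have k10 : k1 <> k0 by [].
have cardX : [set: hedgehog R k0] #= [set: kappa].
  apply: card_eq_trans JC.
  pose f (x : (J * bool) * unit_rat) := (x.1.1, (x.1.2, x.2)).
  pose g (x : J * (bool * unit_rat)) := ((x.1, x.2.1), x.2.2).
  by apply: (@card_eqTT_inj _ _ f g); [move=> [[? ?] ?] [[? ?] ?] [-> -> ->]|
    move=> [? [? ?]] [? [? ?]] [-> -> ->]].
exists (hedgehog R k0); split=> //.
- apply/card_le2TP; have /infiniteP/card_leTT_inj[f _] := unit_rat_infinite.
  by exists (k0, f 0%N), (k1, f 0%N).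
- exact/chain_connected_alpha_connected/hedgehog_chain_connected.
- exact: diam_hedgehog k10.
- exact: d2_hedgehog k10.
Qed.

Local Open Scope ereal_scope.

Theorem theorem11p1 (R : realType) :
  (forall X Y : metricType R,
     [set: 'I_2] #<= [set: X] -> [set: 'I_2] #<= [set: Y] ->
     alpha_connected X -> alpha_connected Y ->
     diam X = diam Y ->
     d_ 'I_2 X <= diam X * (2^-1)%:E ->
     d_ 'I_2 Y <= diam Y * (2^-1)%:E ->
     indistinguishable X Y)
  /\
  (forall kappa mu : Type,
     [set: R] #<= [set: kappa] -> [set: R] #<= [set: mu] ->
     exists X Y : metricType R,
       [/\ [set: X] #= [set: kappa], [set: Y] #= [set: mu] &
           indistinguishable X Y]).
Proof.
split=> [X Y|kappa mu R_kappa R_mu].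
  exact: alpha_connected_indistinguishable.
have nat_R : [set: nat] #<= [set: R].
  by apply/card_leTT_inj; exists (fun n => n%:R) => m n /mulrIn ->.
have [X [cardX X2 aX diamX dX]] :
    _ := exists_hedgehog_of_card R ((infiniteP _).2 (card_le_trans nat_R R_kappa)).
have [Y [cardY Y2 aY diamY dY]] :
    _ := exists_hedgehog_of_card R ((infiniteP _).2 (card_le_trans nat_R R_mu)).
exists X, Y; split=> //.
by apply: alpha_connected_indistinguishable; rewrite // diamX.
Qed.
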